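(* Let $m\ge 1$ and let $X_{2m}$ be the $2m\times 2m$ $(0,1)$-matrix whose cell $(i,j)$ ($1\le i,j\le 2m$) contains $0$ if $i-j\equiv k \pmod{2m}$ for some $k\in\{1,2,\dots,m-1,2m-1\}$, and contains $1$ otherwise. Then $X_{2m}\in\Lambda_{2m}^m$ and $X_{2m}$ has a critical set of size $3m^2-4m+2$.
   Context: $\Lambda_{n}^{x}$ is the set of $n\times n$ $(0,1)$-matrices with every row sum and every column sum equal to $x$. A matrix $M$ is identified with the set of triples $\{(i,j,M_{ij})\}$. A subset $D\subseteq M$ is a defining set for $M$ if $M$ is the unique element of $\Lambda_{2m}^m$ containing $D$; a critical set is a defining set none of whose proper subsets is a defining set; its size is its number of triples. *)

(* Defs.v *)
From mathcomp Require Import all_boot all_order all_algebra.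

Set Implicit Arguments.
Unset Strict Implicit.
Unset Printing Implicit Defensive.

(* (0,1)-matrices are matrices over bool; a bool coerces to the nat 0 or 1,
   so the sums below are sums of natural numbers. *)
Definition Lambda (n x : nat) : {set 'M[bool]_n} :=
  [set M : 'M[bool]_n | [forall i : 'I_n, \sum_(j < n) (M i j : nat) == x]
                     && [forall j : 'I_n, \sum_(i < n) (M i j : nat) == x]].

Definition triples (n : nat) (M : 'M[bool]_n) : {set 'I_n * 'I_n * bool} :=
  [set (p, M p.1 p.2) | p : 'I_n * 'I_n].

Definition defining_set (m : nat) (M : 'M[bool]_(2 * m))
    (D : {set 'I_(2 * m) * 'I_(2 * m) * bool}) : Prop :=
  [/\ M \in Lambda (2 * m) m,
      D \subset triples M
    & forall N : 'M[bool]_(2 * m),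
        N \in Lambda (2 * m) m -> D \subset triples N -> N = M].

Definition critical_set (m : nat) (M : 'M[bool]_(2 * m))
    (D : {set 'I_(2 * m) * 'I_(2 * m) * bool}) : Prop :=
  defining_set M D /\
  forall D' : {set 'I_(2 * m) * 'I_(2 * m) * bool},
    D' \proper D -> ~ defining_set M D'.

(* Rows and columns are numbered from 0 instead of 1, which leaves i - j
   unchanged; i - j = k modulo 2m is written without subtraction.  The list
   is 1, ..., m - 1, 2m - 1 (only 2m - 1 = 1 when m = 1). *)
Definition X (m : nat) : 'M[bool]_(2 * m) :=
  \matrix_(i < 2 * m, j < 2 * m)
    ~~ has (fun k : nat => i == j + k %[mod 2 * m])
           (rcons (iota 1 (m - 1)) (2 * m - 1)).

(* Main.v *)
(** Let a cell (i, j) of [X m] be kept in the critical set exactly when its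
    entry equals the truth value of [i < j].  If N agrees with [X m] on these
    cells, then N - X m is <= 0 where 2(i - j) + 1 > 0 and >= 0 where
    2(i - j) + 1 < 0; as the rows and columns of N - X m sum to 0, the sum of
    (N - X m)_ij (2(i - j) + 1) vanishes, so N = X m.
    Conversely the diagonal of [X m] consists of 1s and its superdiagonal of
    0s, and none of these cells is kept.  Any kept cell closes up, with a
    segment of this staircase, to an alternating cycle, and switching the
    entries along that cycle gives another matrix with the same margins. *)
Require Import Defs.
From mathcomp Require Import all_boot all_order all_algebra.
From mathcomp Require Import perm zify.

Set Implicit Arguments.
Unset Strict Implicit.
Unset Printing Implicit Defensive.

Import Order.TTheory GRing.Theory Num.Theory.

(** * Entries and margins of [X m] *)

Lemma X_entry (m : nat) (i j : 'I_(2 * m)) :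
  X m i j = if j <= i then (i == j :> nat) || (m <= i - j < 2 * m - 1)
            else 1 < j - i <= m.
Proof.
have := ltn_ord i; have := ltn_ord j.
rewrite mxE; move: (i : nat) (j : nat) => {}i {}j jm im.
(* As [i < 2 * m] and [j + k < 4 * m], a congruence is either an equality or a single wrap-around by
   [2 * m]. *)
have modE k : k < 2 * m ->
    (i == j + k %[mod 2 * m]) = (i == j + k) || (i + 2 * m == j + k).
  move=> km; rewrite (modn_small im).
  have [lt_jk|le_jk] := ltnP (j + k) (2 * m); first by rewrite modn_small //; lia.
  rewrite -[j + k](subnK le_jk) modnDr modn_small; lia.
apply/idP/idP => [/hasPn h|h].
- have h' k : (0 < k < m) || (k == 2 * m - 1) ->
      ~~ ((i == j + k) || (i + 2 * m == j + k)).
    move=> hk; rewrite -modE; last by lia.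
    by apply: h; rewrite mem_rcons in_cons mem_iota; lia.
  have := h' (i - j); have := h' (i + 2 * m - j); case: ifP => ?; lia.
- apply/hasPn => k; rewrite mem_rcons in_cons mem_iota => hk.
  rewrite modE; last by lia.
  by move: h; case: ifP => ?; lia.
Qed.

Lemma sum_ord_recr_bool (P : pred nat) n :
  \sum_(d < n.+1) (P d : nat) = \sum_(d < n) (P d : nat) + P n.
Proof. exact: big_ord_recr. Qed.

Lemma sum_interval a b n : \sum_(d < n) (a <= d < b : nat) = minn n b - a.
Proof.
elim: n => [|n IH]; first by rewrite big_ord0; lia.
by rewrite (sum_ord_recr_bool (fun d => a <= d < b)) IH; lia.
Qed.

Lemma sum_zero_or_interval a b n : 0 < a ->
  \sum_(d < n) ((d == 0 :> nat) || (a <= d < b) : nat)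
  = (0 < n) + (minn n b - a).
Proof.
move=> a0; elim: n => [|n IH]; first by rewrite big_ord0; lia.
by rewrite (sum_ord_recr_bool (fun d => (d == 0) || (a <= d < b))) IH; lia.
Qed.

Definition cyc_sub (n i d : nat) : nat := if d <= i then i - d else i + n - d.

Lemma cyc_sub_lt n (i d : 'I_n) : cyc_sub n i d < n.
Proof.
by have := ltn_ord i; have := ltn_ord d; rewrite /cyc_sub; case: ifP; lia.
Qed.

Definition ord_cyc_sub n (i d : 'I_n) : 'I_n := Ordinal (cyc_sub_lt i d).

Lemma ord_cyc_subK n (i : 'I_n) : involutive (ord_cyc_sub i).
Proof.
move=> d; apply: val_inj; have := ltn_ord i; have := ltn_ord d.
by rewrite /= /cyc_sub; do ![case: ifP]; lia.
Qed.

Definition cyc_add (n j d : nat) : nat := if j + d < n then j + d else j + d - n.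

Lemma cyc_add_lt n (j d : 'I_n) : cyc_add n j d < n.
Proof.
by have := ltn_ord j; have := ltn_ord d; rewrite /cyc_add; case: ifP; lia.
Qed.

Definition ord_cyc_add n (j d : 'I_n) : 'I_n := Ordinal (cyc_add_lt j d).

Lemma ord_cyc_add_inj n (j : 'I_n) : injective (ord_cyc_add j).
Proof.
move=> d e /(congr1 val); have := ltn_ord j; have := ltn_ord d; have := ltn_ord e.
rewrite /= /cyc_add => lte ltd ltj h; apply: val_inj => /=.
by move: h; do ![case: ifP]; lia.
Qed.

(** Each row and each column is reindexed by the cyclic difference [d] of row and column index, on
    which alone the entry depends. It is 1 for [d = 0] and for [m <= d < 2 * m - 1], which makes
    [1 + (m - 1)] ones. *)
Lemma X_in_Lambda (m : nat) : 0 < m -> X m \in Lambda (2 * m) m.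
Proof.
move=> m0; have count_g : \sum_(d < 2 * m)
    ((d == 0 :> nat) || (m <= d < 2 * m - 1) : nat) = m.
  by rewrite sum_zero_or_interval //; lia.
rewrite inE; apply/andP; split; apply/forallP => i; apply/eqP.
- rewrite (reindex_inj (can_inj (ord_cyc_subK i))) -[RHS]count_g.
  apply: eq_bigr => d _; rewrite X_entry /= /cyc_sub.
  by have := ltn_ord i; have := ltn_ord d; do ![case: ifP]; lia.
- rewrite (reindex_inj (@ord_cyc_add_inj _ i)) -[RHS]count_g.
  apply: eq_bigr => d _; rewrite X_entry /= /cyc_add.
  by have := ltn_ord i; have := ltn_ord d; do ![case: ifP]; lia.
Qed.

(** * The kept cells determine the matrix *)

Definition kept_cells (n : nat) (M : 'M[bool]_n) : {set 'I_n * 'I_n} :=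
  [set p : 'I_n * 'I_n | M p.1 p.2 == (p.1 < p.2)].

Definition kept (n : nat) (M : 'M[bool]_n) : {set 'I_n * 'I_n * bool} :=
  [set (p, M p.1 p.2) | p in kept_cells M].

Lemma mem_triples n (M : 'M[bool]_n) p b : ((p, b) \in triples M) = (M p.1 p.2 == b).
Proof.
apply/imsetP/eqP => [[q _ [-> ->]] //|<-]; by exists p.
Qed.

Lemma Lambda_row n x (M : 'M[bool]_n) i :
  M \in Lambda n x -> \sum_j (M i j : nat) = x.
Proof. by rewrite inE => /andP[/forallP /(_ i) /eqP]. Qed.

Lemma Lambda_col n x (M : 'M[bool]_n) j :
  M \in Lambda n x -> \sum_i (M i j : nat) = x.
Proof. by rewrite inE => /andP[_ /forallP /(_ j) /eqP]. Qed.

Section Potential.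
Local Open Scope ring_scope.

(** The weight splits into a row part [2i + 1] and a column part [2j], so the weighted sum sees only
    the margins and is the same for all members of [Lambda n x]. *)
Lemma sum_potential n x (M : 'M[bool]_n) : M \in Lambda n x ->
  \sum_i \sum_j (M i j)%:Z * (2 * (i%:Z - j%:Z) + 1)
  = x%:Z * (\sum_(i < n) (2 * i%:Z + 1) - \sum_(j < n) 2 * j%:Z).
Proof.
move=> hM.
have rowE i : \sum_j (M i j)%:Z = x%:Z 
  by rewrite -(Lambda_row i hM) -natz natr_sum; apply: eq_bigr => j _; rewrite natz.
have colE j : \sum_i (M i j)%:Z = x%:Z 
  by rewrite -(Lambda_col j hM) -natz natr_sum; apply: eq_bigr => i _; rewrite natz.
transitivity (\sum_i \sum_j (M i j)%:Z * (2 * i%:Z + 1)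
              - \sum_i \sum_j (M i j)%:Z * (2 * j%:Z)).
  rewrite -sumrB; apply: eq_bigr => i _; rewrite -sumrB.
  by apply: eq_bigr => j _; lia.
rewrite mulrBr !mulr_sumr; congr (_ - _).
  by apply: eq_bigr => i _; rewrite -mulr_suml rowE.
by rewrite exchange_big; apply: eq_bigr => j _; rewrite -mulr_suml colE.
Qed.

Lemma kept_unique n x (M N : 'M[bool]_n) :
  M \in Lambda n x -> N \in Lambda n x -> kept M \subset triples N -> N = M.
Proof.
move=> hM hN /subsetP hD.
pose f i j := ((M i j)%:Z - (N i j)%:Z) * (2 * ((i : 'I_n)%:Z - (j : 'I_n)%:Z) + 1).
have agree i j : M i j = (i < j)%N -> N i j = M i j.
  move=> Mij; have : ((i, j), M i j) \in kept M.
    by apply/imsetP; exists (i, j); rewrite ?inE /= ?Mij.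
  by move/hD; rewrite mem_triples => /eqP.
(* Off the kept cells, an entry 1 of [M] has [j <= i] and positive weight, an entry 0 has [i < j]
   and negative weight. In both cases the difference [M - N] cannot have the opposite sign. *)
have f_ge0 i j : 0 <= f i j.
  rewrite /f; have := agree i j.
  case: (M i j) (N i j) => -[]; case: ltnP => //= ? H; try lia;
    by have := H erefl.
have sum0 : \sum_i \sum_j f i j = 0.
  transitivity (\sum_i \sum_j (M i j)%:Z * (2 * (i%:Z - j%:Z) + 1)
     - \sum_i \sum_j (N i j)%:Z * (2 * (i%:Z - j%:Z) + 1)).
    rewrite -sumrB; apply: eq_bigr => i _; rewrite -sumrB.
    by apply: eq_bigr => j _; rewrite -mulrBl.
  by rewrite (sum_potential hM) (sum_potential hN) subrr.
apply/matrixP => i j.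
have fi0 : \sum_j f i j = 0.
  by apply: (psumr_eq0P _ sum0) => // k _; apply: sumr_ge0.
have : f i j = 0 by apply: (psumr_eq0P _ fi0).
(* The weight is odd, hence nonzero even next to the diagonal, so the difference itself vanishes. *)
by rewrite /f; case: (M i j) (N i j) => -[] //=; lia.
Qed.

End Potential.

(** * Switching along an alternating cycle *)

Lemma sum_swap n (f g : 'I_n -> bool) a b : f a = g b -> f b = g a ->
  (forall j, j != a -> j != b -> f j = g j) ->
  \sum_j (f j : nat) = \sum_j (g j : nat).
Proof.
move=> fa fb fj; rewrite [RHS](reindex_inj (@perm_inj _ (tperm a b))).
apply: eq_bigr => j _; congr nat_of_bool.
by case: tpermP => [->|->|/eqP ja /eqP jb] //; apply: fj.
Qed.

(* The alternating cycle through the cell (p, q): the cells (k, k) and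
   (k, k.+1) of the staircase that lead from row p to column q when q <= p,
   and from column q to row p when p < q. *)
Definition cycle_cell (p q i j : nat) : bool :=
  [|| (i == p) && (j == q),
      (i == j) && (if q <= p then q <= i <= p else p < i < q)
    | (j == i.+1) && (if q <= p then q <= i < p else p <= i < q)].

Definition switch_cycle n (M : 'M[bool]_n) (p q : 'I_n) : 'M[bool]_n :=
  \matrix_(i, j) (M i j (+) cycle_cell p q i j).

Section Switch.
Variables (n x : nat) (M : 'M[bool]_n) (p q : 'I_n).
Hypothesis diagM : forall i, M i i.
Hypothesis superM : forall i j : 'I_n, j = i.+1 :> nat -> M i j = false.
Hypothesis keptM : M p q = (p < q).

(** A kept cell avoids the diagonal and, by the next fact, the superdiagonal; hence it is not itself
    a cell of the staircase. *)
Let neq_pq : p != q.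
Proof. by apply/eqP => e; have := keptM; rewrite e diagM ltnn. Qed.

Let nsuper_pq : q != p.+1 :> nat.
Proof. by apply/eqP => e; have := keptM; rewrite (superM e) e ltnSn. Qed.

Let diag_entry (i j : 'I_n) : i = j :> nat -> M i j.
Proof. by move/val_inj->. Qed.

(** Negating two different truth values exchanges them. This is what happens in each line that the
    cycle meets. *)
Let sum_flip (f h : 'I_n -> bool) a b : f a != f b ->
  (forall j, h j = (j == a) || (j == b)) ->
  \sum_j (f j (+) h j : nat) = \sum_j (f j : nat).
Proof.
move=> fab hE; apply: (@sum_swap _ _ _ a b).
- by rewrite hE eqxx; case: (f a) (f b) fab => -[].
- by rewrite hE eqxx orbT; case: (f a) (f b) fab => -[].
- by move=> j ja jb; rewrite hE (negbTE ja) (negbTE jb) addbF.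
Qed.

Let sum_noflip (f h : 'I_n -> bool) : (forall j, h j = false) ->
  \sum_j (f j (+) h j : nat) = \sum_j (f j : nat).
Proof. by move=> hE; apply: eq_bigr => j _; rewrite hE addbF. Qed.

(** The cycle meets a row in two cells with opposite entries or not at all. Row [p] holds [(p, q)]
    and an end of the staircase segment, [(p, p)] if [q <= p] and [(p, p.+1)] otherwise; any other
    row that is met holds [(i, i)] and [(i, i.+1)]. *)
Lemma switch_row i :
  \sum_j (switch_cycle M p q i j : nat) = \sum_j (M i j : nat).
Proof.
under eq_bigr do rewrite mxE.
have := neq_pq; have := nsuper_pq; have ltp := ltn_ord p; have ltq := ltn_ord q.
have lti := ltn_ord i.
rewrite -val_eqE /= => nsup neq.
have [le_qp|lt_pq] := leqP q p.
- have Mpq : M p q = false by rewrite keptM ltnNge le_qp.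
  have [eip|nip] := eqVneq i p.
    subst i; apply: (@sum_flip _ _ p q); first by rewrite diagM Mpq.
    by move=> j; rewrite /cycle_cell -!val_eqE /= le_qp; lia.
  have [hi|hi] := boolP (q <= i < p).
    have lt_i1 : i.+1 < n by lia.
    apply: (@sum_flip _ _ i (Ordinal lt_i1)).
      by rewrite diagM (@superM i (Ordinal lt_i1)).
    move=> j; rewrite /cycle_cell -!val_eqE /= le_qp.
    by move: nip; rewrite -val_eqE /=; lia.
  apply: sum_noflip => j; rewrite /cycle_cell le_qp.
  by move: nip; rewrite -val_eqE /=; lia.
- have Mpq : M p q by rewrite keptM.
  have nle : (q <= p) = false by lia.
  have [eip|nip] := eqVneq i p.
    subst i; have lt_p1 : p.+1 < n by lia.
    apply: (@sum_flip _ _ (Ordinal lt_p1) q).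
      by rewrite Mpq (@superM p (Ordinal lt_p1)).
    by move=> j; rewrite /cycle_cell -!val_eqE /= nle; lia.
  have [hi|hi] := boolP (p < i < q).
    have lt_i1 : i.+1 < n by lia.
    apply: (@sum_flip _ _ i (Ordinal lt_i1)).
      by rewrite diagM (@superM i (Ordinal lt_i1)).
    move=> j; rewrite /cycle_cell -!val_eqE /= nle.
    by move: nip; rewrite -val_eqE /=; lia.
  apply: sum_noflip => j; rewrite /cycle_cell nle.
  by move: nip; rewrite -val_eqE /=; lia.
Qed.

(** Here column [q] holds [(p, q)] and either [(q, q)] or [(q.-1, q)]; any other column that is met
    holds [(j, j)] and [(j.-1, j)]. *)
Lemma switch_col j :
  \sum_i (switch_cycle M p q i j : nat) = \sum_i (M i j : nat).
Proof.
under eq_bigr do rewrite mxE.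
have := neq_pq; have := nsuper_pq; have ltp := ltn_ord p; have ltq := ltn_ord q.
have ltj := ltn_ord j.
rewrite -val_eqE /= => nsup neq.
have [le_qp|lt_pq] := leqP q p.
- have Mpq : M p q = false by rewrite keptM ltnNge le_qp.
  have [ejq|njq] := eqVneq j q.
    subst j; apply: (@sum_flip (M^~ q) _ q p); first by rewrite diagM Mpq.
    by move=> i; rewrite /cycle_cell -!val_eqE /= le_qp; lia.
  have [hj|hj] := boolP (q < j <= p).
    have lt_j1 : j.-1 < n by lia.
    apply: (@sum_flip (M^~ j) _ j (Ordinal lt_j1)).
      by rewrite diagM (@superM (Ordinal lt_j1) j) //=; lia.
    move=> i; rewrite /cycle_cell -!val_eqE /= le_qp.
    by move: njq; rewrite -val_eqE /=; lia.
  apply: (@sum_noflip (M^~ j)) => i; rewrite /cycle_cell le_qp.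
  by move: njq; rewrite -val_eqE /=; lia.
- have Mpq : M p q by rewrite keptM.
  have nle : (q <= p) = false by lia.
  have [ejq|njq] := eqVneq j q.
    subst j; have lt_q1 : q.-1 < n by lia.
    apply: (@sum_flip (M^~ q) _ (Ordinal lt_q1) p).
      by rewrite Mpq (@superM (Ordinal lt_q1) q) //=; lia.
    by move=> i; rewrite /cycle_cell -!val_eqE /= nle; lia.
  have [hj|hj] := boolP (p < j < q).
    have lt_j1 : j.-1 < n by lia.
    apply: (@sum_flip (M^~ j) _ j (Ordinal lt_j1)).
      by rewrite diagM (@superM (Ordinal lt_j1) j) //=; lia.
    move=> i; rewrite /cycle_cell -!val_eqE /= nle.
    by move: njq; rewrite -val_eqE /=; lia.
  apply: (@sum_noflip (M^~ j)) => i; rewrite /cycle_cell nle.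
  by move: njq; rewrite -val_eqE /=; lia.
Qed.

Lemma switch_in_Lambda : M \in Lambda n x -> switch_cycle M p q \in Lambda n x.
Proof.
move=> hM; rewrite inE; apply/andP; split; apply/forallP => k; apply/eqP.
  by rewrite switch_row (Lambda_row k hM).
by rewrite switch_col (Lambda_col k hM).
Qed.

Lemma switch_neq : switch_cycle M p q <> M.
Proof.
by move/matrixP/(_ p q); rewrite mxE /cycle_cell !eqxx /=; case: (M p q).
Qed.

(** Apart from [(p, q)] the cycle runs on the diagonal and superdiagonal, where no cell is kept. *)
Lemma switch_agree i j : M i j = (i < j) -> (i, j) <> (p, q) ->
  switch_cycle M p q i j = M i j.
Proof.
move=> Mij ne; rewrite mxE /cycle_cell.
have -> : (i == p :> nat) && (j == q :> nat) = false.
  by apply/negP => /andP[/eqP/val_inj ei /eqP/val_inj ej]; case: ne; rewrite ei ej.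
have -> : (i == j :> nat) = false.
  by apply/negP => /eqP e; move: Mij; rewrite (diag_entry e) e ltnn.
have -> : (j == i.+1 :> nat) = false.
  by apply/negP => /eqP e; move: Mij; rewrite (superM e) e ltnSn.
exact: addbF.
Qed.

End Switch.

Lemma kept_critical m (M : 'M[bool]_(2 * m)) : M \in Lambda (2 * m) m ->
  (forall i, M i i) ->
  (forall i j : 'I_(2 * m), j = i.+1 :> nat -> M i j = false) ->
  critical_set M (kept M).
Proof.
move=> hM diagM superM; split.
  split=> // [|N hN hD]; last exact: kept_unique hM hN hD.
  by apply/subsetP => _ /imsetP[p _ ->]; rewrite mem_triples.
move=> D' /properP[/subsetP sub [c /imsetP[[p q]]]].
rewrite inE /= => /eqP keptM -> {c} notin [_ _ uniqM].
(* [D'] omits the triple of the kept cell [(p, q)], so the matrix switched through that cell still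
   contains [D'], against uniqueness. *)
apply: (@switch_neq _ M p q); apply: uniqM; first exact: switch_in_Lambda.
apply/subsetP => t tD'; have /imsetP[[i j]] := sub t tD'.
rewrite inE /= => /eqP Mij et; rewrite et mem_triples /=.
apply/eqP/switch_agree => // -[ei ej].
by move: notin; rewrite -ei -ej -et tD'.
Qed.

(** * The number of kept cells *)

Definition row_kept (m i : nat) : nat :=
  minn i (m - 1) + (i == 2 * m - 1) + (minn m (2 * m - 1 - i) - 1).

(** The three terms of [row_kept] count the zeros with [1 <= i - j <= m - 1], the zero with
    [i - j = 2 * m - 1], and the ones with [2 <= j - i <= m]. *)
Lemma kept_X_row m (i : 'I_(2 * m)) :
  \sum_j (X m i j == (i < j) : nat) = row_kept m i.
Proof.
have lti := ltn_ord i.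
(* The middle interval, bounded by a truth value, is the single column 0 in the last row and empty
   in all others. *)
transitivity (\sum_(j < 2 * m) ((i - (m - 1) <= j < i)
    + (0 <= j < (i == 2 * m - 1 :> nat)) + (i + 2 <= j < i + m + 1))).
  apply: eq_bigr => j _; have ltj := ltn_ord j; rewrite X_entry.
  case: (ltnP i j) => hij; first by rewrite eqb_id; lia.
  by rewrite eqbF_neg; lia.
rewrite !big_split /= !sum_interval (sum_interval 0) subn0 /row_kept.
have -> : minn (2 * m) i = i by lia.
have -> : minn (2 * m) (i == 2 * m - 1 :> nat) = (i == 2 * m - 1 :> nat) by lia.
have -> : minn (2 * m) (i + m + 1) - (i + 2) = minn m (2 * m - 1 - i) - 1 by lia.
by congr (_ + _ + _); lia.
Qed.

Lemma card_kept n (M : 'M[bool]_n) :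
  #|kept M| = \sum_i \sum_j (M i j == (i < j) : nat).
Proof.
rewrite card_imset; last by move=> p q [].
rewrite -sum1_card pair_big /= big_mkcond /=.
by apply: eq_bigr => p _; rewrite inE; case: eqP.
Qed.

(** Rows [i] and [i + m] together keep [3m - 4] cells, with two more for [i = m - 1]: the corner
    cell of the last row, and a truncated subtraction giving 0 instead of -1 there. Adding [4 * m]
    on the left keeps the identity within the naturals. *)
Lemma sum_row_kept m : 0 < m ->
  \sum_(i < 2 * m) row_kept m i + 4 * m = 3 * m ^ 2 + 2.
Proof.
move=> m0; rewrite -(big_mkord xpredT (row_kept m)).
rewrite (@big_cat_nat _ _ _ m) //=; last by lia.
have -> : \sum_(m <= i < 2 * m) row_kept m i
        = \sum_(0 <= i < m) row_kept m (i + m).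
  by rewrite -{1}[m]add0n big_addn; congr bigop; rewrite /index_iota; congr iota; lia.
rewrite -big_split /=.
have part k : k <= m ->
  \sum_(0 <= i < k) (row_kept m i + row_kept m (i + m)) + 4 * k
  = 3 * m * k + 2 * (k == m).
  elim: k => [|k IH] hk; first by rewrite big_geq //; lia.
  rewrite big_nat_recr //=; have := IH (ltnW hk).
  have -> : (k == m) = false by lia.
  have : row_kept m k + row_kept m (k + m) + 4 = 3 * m + 2 * (k.+1 == m).
    rewrite /row_kept.
    have -> : minn k (m - 1) = k by lia.
    have -> : minn (k + m) (m - 1) = m - 1 by lia.
    have -> : (k == 2 * m - 1) = false by lia.
    have -> : minn m (2 * m - 1 - k) = m by lia.
    have -> : minn m (2 * m - 1 - (k + m)) = m - k.+1 by lia.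
    have -> : (k + m == 2 * m - 1) = (k.+1 == m) by lia.
    by case: eqP; lia.
  by rewrite mulnS; lia.
by rewrite part // eqxx; lia.
Qed.

Theorem theorem13 (m : nat) (hm : 1 <= m) :
  X m \in Lambda (2 * m) m /\
  exists D : {set 'I_(2 * m) * 'I_(2 * m) * bool},
    critical_set (X m) D /\
    (#|D|%:Z = 3 * m%:Z ^+ 2 - 4 * m%:Z + 2)%R.
Proof.
split; first exact: X_in_Lambda.
exists (kept (X m)); split.
  apply: kept_critical; first exact: X_in_Lambda.
    by move=> i; rewrite X_entry leqnn eqxx.
  by move=> i j e; rewrite X_entry e; case: ifP; lia.
rewrite card_kept; under eq_bigr do rewrite kept_X_row.
have := sum_row_kept hm; rewrite expr2 -mulnn.
by move: (\sum_(i < _) _) => s; lia.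
Qed.
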